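(* Let $A\in M_n(\mathbb{Z})$ be invertible such that $x\mapsto A^{-1}x$ is a similarity with respect to Euclidean distance, and let $D$ be a subset of a complete residue system mod $A$. Let $(D_j)_{j\ge1}$ be a sequence of nonempty subsets of $D$ and put $G_k=\prod_{j=1}^k|D_j|$. Then $$\underline{\dim}_B\,\pi_{A,D}\Big(\prod_{j=1}^\infty D_j\Big)=\liminf_{k\to\infty}\frac{\log G_k}{k\log|\det(A)|^{1/n}},\qquad \overline{\dim}_B\,\pi_{A,D}\Big(\prod_{j=1}^\infty D_j\Big)=\limsup_{k\to\infty}\frac{\log G_k}{k\log|\det(A)|^{1/n}}.$$
   Context: A similarity means a map $f$ with $\|f(x)-f(y)\|=c\|x-y\|$ for some $c\in(0,1)$ and all $x,y$. For finite $D\subset\mathbb{R}^n$, $\pi_{A,D}:D^{\mathbb{N}}\to\mathbb{R}^n$, $\pi_{A,D}((d_j)_{j\ge1})=\sum_{j\ge1}A^{-j}d_j$. A set $\mathcal{D}\subset\mathbb{Z}^n$ is a complete residue system mod $A$ if the canonical map $\mathcal{D}\to\mathbb{Z}^n/A\mathbb{Z}^n$ is bijective. *)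

(* Defs.v *)
From HB Require Import structures.
From mathcomp Require Import all_boot all_order all_algebra.
From mathcomp Require Import finmap.
From mathcomp Require Import all_classical all_reals all_analysis.
Set Implicit Arguments. Unset Strict Implicit. Unset Printing Implicit Defensive.
Import Order.TTheory GRing.Theory Num.Theory.
Import numFieldNormedType.Exports.
Local Open Scope classical_set_scope.
Local Open Scope ring_scope.

Section Defs.
Variable R : realType.

Definition eucl_norm (n : nat) (v : 'cV[R]_n) : R :=
  Num.sqrt (\sum_(i < n) v i 0 ^+ 2).

Definition mxR (m n : nat) (M : 'M[int]_(m, n)) : 'M[R]_(m, n) :=
  map_mx (fun z : int => z%:~R) M.

Definition inv_similarity (n : nat) (A : 'M[int]_n) : Prop :=
  exists c : R, 0 < c < 1 /\
    forall x y : 'cV[R]_n,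
      eucl_norm (invmx (mxR A) *m x - invmx (mxR A) *m y) = c * eucl_norm (x - y).

(* pi_{A,D}((d_j)_{j>=1}) = sum_{j>=1} A^{-j} d_j, with d_j stored at index j-1 *)
Definition piAD (n : nat) (A : 'M[int]_n) (d : nat -> 'cV[int]_n) : 'cV[R]_n :=
  limn (fun k : nat => \sum_(0 <= j < k) (invmx (mxR A)) ^+ j.+1 *m mxR (d j)).

Definition cover_num (n : nat) (F : set 'cV[R]_n) (delta : R) : \bar R :=
  ereal_inf [set (k%:R)%:E | k in [set k : nat |
     exists U : 'I_k -> set 'cV[R]_n,
       (forall i x y, U i x -> U i y -> eucl_norm (x - y) <= delta) /\
       F `<=` \bigcup_i U i]].

Definition box_ratio (n : nat) (F : set 'cV[R]_n) (delta : R) : \bar R :=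
  match cover_num F delta with
  | EFin N => (ln N / (- ln delta))%:E
  | _ => +oo%E
  end.

Definition lower_box_dim (n : nat) (F : set 'cV[R]_n) : \bar R :=
  limf_einf (box_ratio F) (0 : R)^'+.
Definition upper_box_dim (n : nat) (F : set 'cV[R]_n) : \bar R :=
  limf_esup (box_ratio F) (0 : R)^'+.

End Defs.

Definition complete_residue_system (n : nat) (A : 'M[int]_n) (C : set 'cV[int]_n) : Prop :=
  (forall z : 'cV[int]_n, exists2 d, C d & exists w : 'cV[int]_n, z = d + A *m w) /\
  (forall d1 d2, C d1 -> C d2 -> (exists w : 'cV[int]_n, d1 - d2 = A *m w) -> d1 = d2).

(* Main.v *)
Require Import Defs.
From HB Require Import structures.
From mathcomp Require Import all_boot all_order all_algebra.
From mathcomp Require Import finmap.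
From mathcomp Require Import all_classical all_reals all_analysis.
From mathcomp Require Import ring lra zify.
Import Order.TTheory GRing.Theory Num.Theory.
Import numFieldNormedType.Exports.
Local Open Scope classical_set_scope.
Local Open Scope ring_scope.

(* Write B = A^-1, with ratio c, so that |det A| = c^-n.  The length-k digit
   strings give integer vectors z = sum_(j < k) A^(k-1-j) d_j, pairwise distinct
   because distinct digits are incongruent mod A; there are G_k of them, and the
   cylinder of z lies within O(c^k) of B^k z.  Hence G_k sets of diameter
   O(c^k) cover F, and conversely a set of diameter c^k meets only boundedly many
   cylinders.  So for c^(k+1) < delta <= c^k the covering number differs from
   G_k by a bounded factor, and the box ratio at delta differs from the quotient
   at k by O(1/k). *)

(** * Upper limits along different filters, and sampling at geometric scales *)

(** A bound for [f] on a member of [F1] becomes, up to [e], a bound for [g] on a member of [F2]. The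
    filters may live on different spaces, so [delta -> 0+] can be compared with [k -> oo] in both
    directions. *)
Lemma limf_esup_le_approx {R : realType} {T1 T2 : choiceType}
    {X : filteredType T1} {Y : filteredType T2}
    (f : X -> \bar R) (g : Y -> \bar R) (F1 : set (set X)) (F2 : set (set Y)) :
  (forall (e : R) A, 0 < e -> F1 A -> exists2 B, F2 B &
     forall y, B y -> exists2 x, A x & (g y <= f x + e%:E)%E) ->
  (limf_esup g F2 <= limf_esup f F1)%E.
Proof.
move=> fg; apply/lee_addgt0Pr => e e0.
rewrite -leeBlDr//; apply: le_ereal_inf_tmp => _ [A F1A <-].
rewrite leeBlDr//; have [B F2B gB] := fg e A e0 F1A.
apply: (@le_trans _ _ (ereal_sup [set g y | y in B])).
  by apply: ereal_inf_lbound; exists B.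
apply: ge_ereal_sup => _ [y By <-]; have [x Ax /le_trans] := gB y By; apply.
by rewrite leeD2r//; apply: ereal_sup_ubound; exists x.
Qed.

Lemma exists_expr_between {R : realType} (c d : R) : 0 < c < 1 -> 0 < d < 1 ->
  exists k, c ^+ k.+1 < d <= c ^+ k.
Proof.
move=> /andP[c0 c1] /andP[d0 d1].
have cd : exists k, c ^+ k < d.
  have /cvgrPdist_lt /(_ d d0) [N _ /(_ N (leqnn N))] :
    geometric 1 c x @[x --> \oo] --> 0 by apply: cvg_geometric; rewrite gtr0_norm.
  rewrite /geometric /= mul1r sub0r normrN ger0_norm ?exprn_ge0 ?ltW// => Nd.
  by exists N.
(* The least exponent with [c ^+ k < d] is not 0 because [d < 1]; its predecessor is the witness. *)
have [[|k] kd kmin] := find_ex_minn cd; first by move: kd; rewrite expr0 ltNge ltW.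
by exists k; rewrite kd/= leNgt; apply/negP => /kmin; rewrite ltnn.
Qed.

Section GeometricScale.
Context {R : realType}.
Variables (f : R -> \bar R) (q : nat -> R) (c K : R).
Hypothesis c01 : 0 < c < 1.
Hypothesis fq : forall k d, (0 < k)%N -> c ^+ k.+1 < d <= c ^+ k ->
  exists2 x, f d = x%:E & `|x - q k| <= K / k%:R.

Let c0 : 0 < c. Proof. by case/andP: c01. Qed.
Let c1 : c < 1. Proof. by case/andP: c01. Qed.

Let K_small (e : R) : 0 < e ->
  exists N, forall k, (N < k)%N -> K / k%:R <= e.
Proof.
move=> e0; exists (Num.bound `|K / e|) => k Nk.
have k0 : 0 < k%:R :> R by rewrite ltr0n (leq_trans _ Nk).
rewrite ler_pdivrMr// mulrC -ler_pdivrMr// (le_trans (ler_norm _))//.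
by apply: le_trans (ltW (archi_boundP _)) _; rewrite ?normr_ge0// ler_nat ltnW.
Qed.

(** Each small [d] is paired with the index of its scale, and conversely each large [k] is tested at
    [d = c ^+ k]; the error [K / k] falls below any [e]. *)
Lemma limf_esup_geometric : limf_esup f (0 : R)^'+ = limn_esup (fun k => (q k)%:E).
Proof.
apply/eqP; rewrite eq_le; apply/andP; split.
- apply: limf_esup_le_approx => e A e0 [N _ NA].
  have [M MK] := K_small e e0.
  (* [c ^+ k.+1 < d < c ^+ (maxn N M).+2] forces [k] beyond both [N] and [M]. *)
  exists [set d | 0 < d < c ^+ (maxn N M).+2].
    apply: filterS2 (nbhs_right_gt (0:R)) (@nbhs_right_lt R 0 (c ^+ (maxn N M).+2) _).
      by move=> d ? ?; apply/andP.
    by rewrite exprn_gt0.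
  move=> d /andP[d0 dN].
  have d1 : d < 1 by apply: (lt_le_trans dN); rewrite exprn_ile1// ltW.
  have [|k kd] := exists_expr_between c d c01; first by rewrite d0 d1.
  have Nk : (maxn N M < k)%N.
    have /andP[+ _] := kd; move=> /lt_trans /(_ dN).
    by rewrite ltr_iXn2l //; lia.
  have [|x -> xk] := fq k d _ kd; first exact: leq_ltn_trans Nk.
  exists k; first by apply: NA => /=; lia.
  rewrite -EFinD lee_fin; have := MK k; move: xk; rewrite ler_norml => /andP[_ ?].
  by move=> /(_ ltac:(lia)); lra.
- apply: limf_esup_le_approx => e A e0 A0.
  have [M MK] := K_small e e0.
  move: A0 => [r /= r0 rA].
  have [N _ Nr] : \forall k \near \oo, c ^+ k < r.
    have /cvgrPdist_lt /(_ r r0) : geometric 1 c x @[x --> \oo] --> 0.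
      by apply: cvg_geometric; rewrite gtr0_norm.
    apply: filterS => k; rewrite /geometric /= mul1r sub0r normrN.
    by rewrite ger0_norm ?exprn_ge0 ?ltW.
  exists [set k | (maxn N M < k)%N]; first by exists (maxn N M).+1.
  move=> k /= Nk; exists (c ^+ k).
    apply: rA; last by rewrite exprn_gt0.
    by rewrite /= sub0r normrN ger0_norm ?exprn_ge0 ?ltW// Nr//=; lia.
  have [||x -> xk] := fq k (c ^+ k); first lia.
    by rewrite lexx ltr_iXn2l// ltnSn.
  rewrite -EFinD lee_fin; have := MK k; move: xk; rewrite ler_norml => /andP[? _].
  by move=> /(_ ltac:(lia)); lra.
Qed.

End GeometricScale.

(** A lower limit is minus the upper limit of the negation, and the closeness hypothesis is
    invariant under negating both functions. *)
Lemma limf_einf_geometric {R : realType} (f : R -> \bar R) (q : nat -> R) (c K : R) :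
  0 < c < 1 ->
  (forall k d, (0 < k)%N -> c ^+ k.+1 < d <= c ^+ k ->
     exists2 x, f d = x%:E & `|x - q k| <= K / k%:R) ->
  limf_einf f (0 : R)^'+ = limn_einf (fun k => (q k)%:E).
Proof.
move=> c01 fq; rewrite /limf_einf /limn_einf; congr (- _)%E.
apply: (@limf_esup_geometric _ _ (fun k => - q k) c K c01) => k d k0 kd.
have [x fx xq] := fq k d k0 kd; exists (- x); first by rewrite fx.
by rewrite -opprD normrN.
Qed.

(** * Euclidean norm, entrywise convergence and geometric tails *)

Section EuclNorm.
Context {R : realType} {n : nat}.
Implicit Types v : 'cV[R]_n.

Lemma sqr_eucl_norm v : eucl_norm v ^+ 2 = \sum_(i < n) v i 0 ^+ 2.
Proof. by rewrite sqr_sqrtr// sumr_ge0// => i _; exact: sqr_ge0. Qed.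

Lemma normr_entry_le_eucl_norm v i : `|v i 0| <= eucl_norm v.
Proof.
rewrite -(ler_pXn2r (ltn0Sn 1)) ?nnegrE ?sqrtr_ge0// sqr_eucl_norm.
rewrite real_normK ?num_real// (bigD1 i)//= lerDl sumr_ge0// => j _.
exact: sqr_ge0.
Qed.

(** The crude factor [n] instead of its square root keeps the constant a natural number; it only
    affects bounded factors later. *)
Lemma eucl_norm_le v (b : R) : 0 <= b -> (forall i, `|v i 0| <= b) ->
  eucl_norm v <= n%:R * b.
Proof.
move=> b0 vb; have nb0 : 0 <= n%:R * b by rewrite mulr_ge0.
rewrite -(ler_pXn2r (ltn0Sn 1)) ?nnegrE ?sqrtr_ge0// sqr_eucl_norm.
apply: (@le_trans _ _ (n%:R * b ^+ 2)).
  rewrite mulr_natl -[in leRHS](card_ord n) -sumr_const; apply: ler_sum => i _.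
  by rewrite -[leLHS]real_normK ?num_real// lerXn2r ?nnegrE.
rewrite exprMn ler_wpM2r ?sqr_ge0// -natrX ler_nat.
by case: (n) => // m; rewrite expnS leq_pmulr.
Qed.

End EuclNorm.

(** Matrix neighbourhoods are given by one neighbourhood per entry, and there are finitely many
    entries. *)
Lemma cvg_mx_entry {T : topologicalType} {m p : nat} (u : nat -> 'M[T]_(m, p))
    (M : 'M[T]_(m, p)) :
  u @ \oo --> M <-> forall i j, (fun k => u k i j) @ \oo --> M i j.
Proof.
split=> [uM i j B MB|uM B [P MP PB]].
  apply: (uM [set N : 'M[T]_(m, p) | B (N i j)]).
  exists (fun i' j' => if (i' == i) && (j' == j) then B else setT).
    move=> i' j'; case: ifPn => [/andP[/eqP -> /eqP ->] //|_]; exact: filterT.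
  by move=> N /(_ i j); rewrite !eqxx.
have : \forall k \near \oo, forall i j, P i j (u k i j).
  apply: filter_forall => i; apply: filter_forall => j; exact: uM (MP i j).
by apply: filterS => k ?; exact: PB.
Qed.

Lemma geometric_series_tail {R : realType} (u : nat -> R) (a c : R) :
  0 < c < 1 -> (forall j, `|u j| <= a * c ^+ j) ->
  exists2 l, series u @ \oo --> l &
    forall k, `|l - series u k| <= a / (1 - c) * c ^+ k.
Proof.
move=> /andP[c0 c1] ua.
have a0 : 0 <= a by move: (ua 0%N); rewrite expr0 mulr1; exact: le_trans.
have tail k m : (k <= m)%N ->
    `|series u m - series u k| <= a / (1 - c) * c ^+ k.
  (* The right-hand side is the exact finite geometric sum from [k] to [m], a form that induction on
     [m - k] preserves. *)
  move=> km; apply: (@le_trans _ _ (a / (1 - c) * (c ^+ k - c ^+ m))).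
    rewrite -(subnK km); elim: (m - k)%N => [|p IHp].
      by rewrite add0n !subrr normr0 mulr0.
    rewrite addSn /series /= big_nat_recr//= addrAC.
    apply: le_trans (ler_normD _ _) _.
    rewrite (_ : _ * _ = a / (1 - c) * (c ^+ k - c ^+ (p + k)) + a * c ^+ (p + k)).
      by rewrite lerD.
    rewrite exprS; field; lra.
  apply: ler_wpM2l; first by rewrite divr_ge0// subr_ge0 ltW.
  by rewrite lerBlDr lerDl exprn_ge0// ltW.
have /cvg_ex[l ul] : cvgn (series u).
  apply: normed_cvg.
  apply: (@series_le_cvg _ _ (geometric a c)); last first.
  - by apply: is_cvg_geometric_series; rewrite gtr0_norm.
  - exact: ua.
  - by move=> j; rewrite /geometric /= mulr_ge0// exprn_ge0// ltW.
  - by move=> j /=.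
exists l => // k.
have : (fun m => `|series u m - series u k|) @ \oo --> `|l - series u k|.
  by apply: cvg_norm; apply: cvgB => //; exact: cvg_cst.
move=> /cvgrPdist_lt lk.
rewrite leNgt; apply/negP => kl.
move: kl; rewrite -subr_gt0 => /lk[N _ NP].
have := NP (maxn N k) (leq_maxl _ _); have := tail k (maxn N k) (leq_maxr _ _).
rewrite ltr_norml => ? /andP[_]; lra.
Qed.

(** * Integer matrices, linear similarities and their determinants *)

Section IntegerMatrix.
Context {R : realType}.

Lemma mxRD {m p : nat} (M N : 'M[int]_(m, p)) : mxR R (M + N) = mxR R M + mxR R N.
Proof. exact: (map_mxD (intmul 1)). Qed.

Lemma mxRB {m p : nat} (M N : 'M[int]_(m, p)) : mxR R (M - N) = mxR R M - mxR R N.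
Proof. exact: (map_mxB (intmul 1)). Qed.

Lemma mxRM {m p r : nat} (M : 'M[int]_(m, p)) (N : 'M[int]_(p, r)) :
  mxR R (M *m N) = mxR R M *m mxR R N.
Proof. exact: (map_mxM (intmul 1)). Qed.

Lemma det_mxR {n : nat} (A : 'M[int]_n) : \det (mxR R A) = (\det A)%:~R.
Proof. exact: (det_map_mx (intmul 1)). Qed.

Lemma mxR_unit {n : nat} (A : 'M[int]_n) : \det A != 0 -> mxR R A \in unitmx.
Proof. by move=> A0; rewrite unitmxE det_mxR unitfE intr_eq0. Qed.

End IntegerMatrix.

Section Similarity.
Context {R : realType} {n : nat}.
Variables (B : 'M[R]_n) (c : R).
Hypothesis simB : forall v : 'cV[R]_n, eucl_norm (B *m v) = c * eucl_norm v.

Lemma eucl_norm_mulmxX k (v : 'cV[R]_n) :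
  eucl_norm (B ^+ k *m v) = c ^+ k * eucl_norm v.
Proof.
elim: k => [|k IHk]; first by rewrite !expr0 mul1mx mul1r.
by rewrite exprS -mulmxE -mulmxA simB IHk mulrA -exprS.
Qed.

(** Polarization: the symmetric form [b] agrees with [c ^+ 2] times the standard one on the
    diagonal, hence everywhere; basis vectors then give the entries. *)
Lemma similarity_gram : B^T *m B = (c ^+ 2)%:M.
Proof.
have normE (v : 'cV[R]_n) : eucl_norm v ^+ 2 = (v^T *m v) 0 0.
  by rewrite sqr_eucl_norm mxE; apply: eq_bigr => i _; rewrite mxE expr2.
pose b (x y : 'cV[R]_n) := (x^T *m (B^T *m B) *m y) 0 0.
have bxx x : b x x = c ^+ 2 * (x^T *m x) 0 0.
  by rewrite /b !mulmxA -mulmxA -trmx_mul -!normE simB exprMn.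
have bD x y : b (x + y) (x + y) = b x x + b y y + (b x y + b y x).
  by rewrite /b [(x + y)^T]raddfD /= !mulmxDl !mulmxDr !mxE; ring.
have bC x y : b x y = b y x.
  rewrite /b; suff -> : y^T *m (B^T *m B) *m x = (x^T *m (B^T *m B) *m y)^T.
    by rewrite [RHS]mxE.
  by rewrite !trmx_mul !trmxK !mulmxA.
have bxy x y : b x y = c ^+ 2 * (x^T *m y) 0 0.
  have := bD x y; rewrite !bxx [(x + y)^T]raddfD /= !mulmxDl !mulmxDr.
  have -> : y^T *m x = (x^T *m y)^T by rewrite trmx_mul trmxK.
  rewrite !mxE (bC y x); lra.
apply/matrixP => i j.
have := bxy (delta_mx i 0) (delta_mx j 0).
rewrite /b !trmx_delta -rowE -colE mul_delta_mx_cond !mxE.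
by case: (i == j); rewrite ?mulr1n ?mulr0n mxE ?mulr1 ?mulr0.
Qed.

Lemma similarity_det : 0 < c -> `|\det B| = c ^+ n.
Proof.
move=> c0; have := congr1 (fun M => \det M) similarity_gram.
rewrite det_mulmx det_tr det_scalar -expr2 -exprM mulnC exprM => /eqP.
rewrite eqf_sqr => /orP[] /eqP ->; rewrite ?normrN ger0_norm//;
  exact/exprn_ge0/ltW.
Qed.

End Similarity.

(** Identifies the logarithm in the denominator of the theorem with the logarithmic size of one
    contraction step. *)
Lemma ln_root_det {R : realType} {n : nat} (A : 'M[int]_n) (c : R) :
  (0 < n)%N -> 0 < c -> `|\det (invmx (mxR R A))| = c ^+ n ->
  ln (`|(\det A)%:~R : R| `^ (n%:R)^-1) = - ln c.
Proof.
move=> n0 c0; rewrite det_inv det_mxR normfV => detA.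
rewrite ln_powR -[X in ln X]invrK detA lnV ?posrE ?exprn_gt0// lnXn//.
by rewrite mulrN -[ln c *+ n]mulr_natl mulKf// pnatr_eq0 -lt0n.
Qed.

(** * Finite digit expansions as integer vectors *)

Section Digits.
Context {n : nat}.
Variable A : 'M[int]_n.

(** Horner form of the sum of [A^(k-1-j) d_j]; applying [A^-k] gives the partial sum of the coding
    map. *)
Fixpoint expansion (d : nat -> 'cV[int]_n) (k : nat) : 'cV[int]_n :=
  if k is k'.+1 then A *m expansion d k' + d k' else 0.

(** A list that may repeat entries, so its length is the product of the digit counts by
    construction; distinctness is proved separately. *)
Fixpoint expansions (Ds : nat -> seq 'cV[int]_n) (k : nat) : seq 'cV[int]_n :=
  if k is k'.+1 then [seq A *m z + d | z <- expansions Ds k', d <- Ds k']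
  else [:: 0].

Lemma eq_expansion d1 d2 k : (forall j, (j < k)%N -> d1 j = d2 j) ->
  expansion d1 k = expansion d2 k.
Proof.
elim: k => //= k IHk d12; rewrite d12// IHk// => j jk.
by apply: d12; rewrite ltnW.
Qed.

Variable Ds : nat -> seq 'cV[int]_n.

Lemma size_expansions k :
  size (expansions Ds k) = (\prod_(0 <= j < k) size (Ds j))%N.
Proof.
elim: k => [|k IHk] /=; first by rewrite big_nil.
by rewrite size_allpairs IHk big_nat_recr.
Qed.

Lemma mem_expansion d k : (forall j, d j \in Ds j) ->
  expansion d k \in expansions Ds k.
Proof.
move=> dD; elim: k => [|k IHk] /=; first by rewrite inE.
exact: allpairs_f.
Qed.

(** Nonempty digit sets let a finite string be continued to an infinite one, here by the first digit
    of each list. *)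
Lemma expansionsP k z : (forall j, Ds j != [::]) -> z \in expansions Ds k ->
  exists2 d, (forall j, d j \in Ds j) & expansion d k = z.
Proof.
move=> Ds0; elim: k z => [|k IHk] z /=.
  rewrite inE => /eqP ->; exists (fun j => head 0 (Ds j)) => // j.
  by have := Ds0 j; case: (Ds j) => //= a s _; rewrite mem_head.
case/allpairsP => -[y a] /= [/IHk[d dD <-] aD ->].
exists (fun j => if j == k then a else d j).
  by move=> j; case: eqP => [->|].
rewrite eqxx; congr (_ *m _ + _); apply: eq_expansion => j jk.
by rewrite ltn_eqF.
Qed.

(** Equality of [A z1 + d1] and [A z2 + d2] makes the last digits congruent mod [A], hence equal;
    then [A] is cancelled and induction applies. *)
Lemma uniq_expansions k : \det A != 0 -> (forall j, uniq (Ds j)) ->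
  (forall j d1 d2, d1 \in Ds j -> d2 \in Ds j ->
     (exists w : 'cV[int]_n, d1 - d2 = A *m w) -> d1 = d2) ->
  uniq (expansions Ds k).
Proof.
move=> A0 uD DA; elim: k => //= k IHk.
apply: allpairs_uniq => // -[z1 d1] [z2 d2] /=.
move=> /allpairsP[[? e1] /= [_ + [_ ->]]] /allpairsP[[? e2] /= [_ + [_ ->]]].
move: e1 e2 => {}d1 {}d2 d1D d2D zd.
have d12 : d1 = d2.
  apply: (DA k) => //; exists (z2 - z1).
  by apply/eqP; rewrite mulmxBr subr_eq addrAC -zd addrC addKr.
(* The adjugate replaces the inverse over the integers: [\det A] times [z1] equals [\det A] times
   [z2]. *)
move: zd; rewrite d12 => /addIr /(congr1 (mulmx (\adj A))).
rewrite !mulmxA mul_adj_mx !mul_scalar_mx => /matrixP z12.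
congr pair; apply/matrixP => i j; apply: (mulfI A0).
by have := z12 i j; rewrite !mxE.
Qed.

End Digits.

(** * Integers recovered from residues; covering numbers *)

Lemma eq_of_modz_close (x y : int) (L : nat) :
  `|(x %% L.+1)%Z|%N = `|(y %% L.+1)%Z|%N -> (`|x - y| <= L)%N -> x = y.
Proof.
move=> /(congr1 Posz); rewrite !gez0_abs ?modz_ge0// => /eqP.
rewrite eqz_mod_dvd dvdzE /= => xyL xy.
apply/eqP; rewrite -subr_eq0 -absz_eq0; apply/negPn/negP; rewrite -lt0n.
by move=> /dvdn_leq /(_ xyL); rewrite leqNgt ltnS xy.
Qed.

Definition covered {R : realType} {n : nat} (F : set 'cV[R]_n) (delta : R) (k : nat) :=
  exists U : 'I_k -> set 'cV[R]_n,
    (forall i x y, U i x -> U i y -> eucl_norm (x - y) <= delta) /\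
    F `<=` \bigcup_i U i.

Lemma covered_le {R : realType} {n : nat} (F : set 'cV[R]_n) (d1 d2 : R) k :
  d1 <= d2 -> covered F d1 k -> covered F d2 k.
Proof.
move=> d12 [U [Ud FU]]; exists U; split=> // i x y Ux Uy.
exact: le_trans (Ud i x y Ux Uy) d12.
Qed.

(** One finite cover suffices for the infimum to be attained, by well-ordering of the naturals. *)
Lemma cover_num_covered {R : realType} {n : nat} (F : set 'cV[R]_n) (delta : R) m :
  covered F delta m ->
  exists N, [/\ cover_num F delta = (N%:R)%:E, covered F delta N & (N <= m)%N].
Proof.
move=> Fm; have Fex : exists k, `[< covered F delta k >] by exists m; apply/asboolP.
have [N /asboolP FN Nmin] := find_ex_minn Fex.
exists N; split=> //; last exact/Nmin/asboolP.
apply/eqP; rewrite eq_le; apply/andP; split.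
  by apply: ereal_inf_lbound; exists N.
apply: le_ereal_inf_tmp => _ [k /= Fk <-].
by rewrite lee_fin ler_nat; exact/Nmin/asboolP.
Qed.

(** * The coding map and two-sided covering bounds for its image *)

Section DigitExpansions.
Context {R : realType} {n : nat}.
Variables (A : 'M[int]_n) (c Delta : R).
Hypothesis A0 : \det A != 0.
Hypothesis c01 : 0 < c < 1.
Let B := invmx (mxR R A).
Hypothesis simB : forall v : 'cV[R]_n, eucl_norm (B *m v) = c * eucl_norm v.

(** Since [B] inverts [A], [B^(k+1) (A z + d) = B^k z + B^(k+1) d], which matches the Horner
    step. *)
Lemma piAD_partial_sum (d : nat -> 'cV[int]_n) k :
  \sum_(0 <= j < k) B ^+ j.+1 *m mxR R (d j) = B ^+ k *m mxR R (expansion A d k).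
Proof.
elim: k => [|k IHk].
  rewrite big_nil -[0](mulmx0 _ (B ^+ 0)); congr (_ *m _).
  by apply/matrixP => i j; rewrite !mxE.
rewrite big_nat_recr//= IHk mxRD mulmxDr mxRM exprSr -mulmxE; congr (_ + _).
by rewrite !mulmxA -[in RHS](mulmxA (B ^+ k)) mulVmx ?mxR_unit// mulmx1.
Qed.

Lemma piAD_tail (d : nat -> 'cV[int]_n) k i :
  (forall j, eucl_norm (mxR R (d j)) <= Delta) ->
  `|(piAD R A d - B ^+ k *m mxR R (expansion A d k)) i 0|
    <= Delta / (1 - c) * c ^+ k.
Proof.
move=> dD; have [c0 c1] := andP c01.
pose u i j := (B ^+ j.+1 *m mxR R (d j)) i 0.
have D0 : 0 <= Delta by apply: le_trans (dD 0%N); rewrite sqrtr_ge0.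
have ule i0 j : `|u i0 j| <= Delta * c ^+ j.
  apply: le_trans (normr_entry_le_eucl_norm _ _) _.
  rewrite (eucl_norm_mulmxX _ _ simB) mulrC; apply: ler_pM => //.
  - by rewrite sqrtr_ge0.
  - by rewrite exprn_ge0 ?ltW.
  - by rewrite exprS ger_pMl ?exprn_gt0// ltW.
have lim_u i0 := geometric_series_tail (u i0) Delta c c01 (ule i0).
pose S k := \sum_(0 <= j < k) B ^+ j.+1 *m mxR R (d j).
have SE k0 i0 : S k0 i0 0 = series (u i0) k0 by rewrite summxE.
pose l i0 := sval (cid2 (lim_u i0)).
have cvgS : S @ \oo --> (\col_i0 l i0).
  apply/cvg_mx_entry => i0 j0; rewrite ord1 mxE.
  rewrite (_ : (fun k => _) = series (u i0)); last by apply/funext => k0; rewrite SE.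
  by rewrite /l; case: (cid2 _).
(* [piAD] is a [lim], so it is the actual limit only once convergence is known, here coordinate by
   coordinate. *)
have cvgpi : S @ \oo --> piAD R A d by apply: (cvgP _ cvgS).
rewrite -piAD_partial_sum mxE [X in _ + X]mxE -/(S k) SE.
have -> : piAD R A d i 0 = l i.
  have /cvg_mx_entry/(_ i 0) cvgpi0 := cvgpi.
  have /cvg_mx_entry/(_ i 0) := cvgS; rewrite mxE => cvgS0.
  exact: (cvg_unique _ cvgpi0 cvgS0).
rewrite /l; case: (cid2 _) => /= l' _; exact.
Qed.

Variable Ds : nat -> seq 'cV[int]_n.
Hypothesis DsDelta : forall j d, d \in Ds j -> eucl_norm (mxR R d) <= Delta.
Hypothesis Ds0 : forall j, Ds j != [::].

Let F := [set piAD R A d | d in [set d : nat -> 'cV[int]_n | forall j, d j \in Ds j]].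
Let T := Delta / (1 - c).

Let T_ge0 : 0 <= T.
Proof.
have [c0 c1] := andP c01.
rewrite divr_ge0 ?subr_ge0 ?(ltW c1)//; have := Ds0 0.
case Ds0E : (Ds 0) => [//|a s] _; apply: le_trans (DsDelta 0 a _).
  by rewrite sqrtr_ge0.
by rewrite Ds0E mem_head.
Qed.

Lemma covered_expansions k :
  covered F (n%:R * (2 * T * c ^+ k)) (\prod_(0 <= j < k) size (Ds j)).
Proof.
have [c0 c1] := andP c01.
rewrite -(size_expansions A).
(* Coordinate boxes of half-side [T * c ^+ k] around the points [B ^+ k z]; each contains the
   cylinder of its [z]. *)
exists (fun a => [set x | forall i,
  `|(x - B ^+ k *m mxR R (nth 0 (expansions A Ds k) a)) i 0| <= T * c ^+ k]); split.
  move=> a x y xa ya; apply: eucl_norm_le.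
    by apply: mulr_ge0; [apply: mulr_ge0|apply/exprn_ge0/ltW].
  move=> i; have := xa i; have := ya i; rewrite !mxE; set w := \sum_j _.
  by rewrite !ler_norml; lra.
move=> _ [d dD <-].
have dk := mem_expansion A Ds d k dD.
move: (dk); rewrite -index_mem => ik; exists (Ordinal ik) => //= i.
rewrite nth_index//; apply: piAD_tail => j; exact: DsDelta (dD j).
Qed.

Hypothesis uDs : forall j, uniq (Ds j).
Hypothesis resDs : forall j d1 d2, d1 \in Ds j -> d2 \in Ds j ->
  (exists w : 'cV[int]_n, d1 - d2 = A *m w) -> d1 = d2.

(* Length-k expansions whose cylinders meet a common set of diameter c^k differ
   by an integer vector with entries bounded by L, so the index of the covering
   set together with the residue mod L.+1 determines the expansion. *)
Lemma covered_ge k N (L : nat) : n%:R * (2 * T + 1) <= L%:R ->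
  covered F (c ^+ k) N ->
  (\prod_(0 <= j < k) size (Ds j) <= L.+1 ^ n * N)%N.
Proof.
move=> TL [U [UN FU]]; have [c0 c1] := andP c01.
rewrite -(size_expansions A); set Z := expansions A Ds k.
have near z : z \in Z -> exists xa : 'cV[R]_n * 'I_N, U xa.2 xa.1 /\
    forall i, `|(xa.1 - B ^+ k *m mxR R z) i 0| <= T * c ^+ k.
  case/(expansionsP _ _ _ _ Ds0) => d dD <-.
  have [a _ Ua] := FU (piAD R A d) (ex_intro2 _ _ d dD erefl).
  by exists (piAD R A d, a); split=> //= i; apply: piAD_tail => j; exact: DsDelta (dD j).
have [->|/negP Z0] := eqVneq Z [::]; first by [].
(* A default index that makes the choice function total outside [Z]. *)
have a0 : 'I_N.
  by case: Z Z0 near => [//|z s] _ /(_ z (mem_head _ _)) /cid [[_ a0] _].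
have /choice[xa Hxa] (z : 'cV[int]_n) : exists xa : 'cV[R]_n * 'I_N,
    z \in Z -> U xa.2 xa.1 /\
    forall i, `|(xa.1 - B ^+ k *m mxR R z) i 0| <= T * c ^+ k.
  have [/near[xa Hxa]|_] := boolP (z \in Z); first by exists xa.
  by exists (0, a0).
have [a Ha] : exists a : 'cV[int]_n -> 'I_N, forall z1 z2, z1 \in Z -> z2 \in Z ->
    a z1 = a z2 -> forall i, (`|z1 i 0%R - z2 i 0%R| <= L)%N.
  exists (fun z => (xa z).2) => z1 z2 z1Z z2Z a12 i.
  have [U1 x1] := Hxa z1 z1Z; have [U2 x2] := Hxa z2 z2Z.
  have ck : 0 < c ^+ k by rewrite exprn_gt0.
  suff : `|mxR R (z1 - z2) i 0| <= L%:R.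
    by rewrite !mxE -intr_norm -[L%:R]/(L%:Z%:~R) ler_int.
  apply: le_trans (normr_entry_le_eucl_norm _ _) _; apply: le_trans TL.
  (* After scaling by [c ^+ k] the vector is [B ^+ k (z1 - z2)]. Passing through two points of the
     common covering set costs [T + 1 + T] times [c ^+ k] per coordinate. *)
  rewrite -(ler_pM2l ck) -(eucl_norm_mulmxX _ _ simB) mulrCA.
  apply: eucl_norm_le.
    by apply: mulr_ge0; rewrite ?(ltW ck)//; apply: addr_ge0 => //; exact: mulr_ge0.
  move=> i0; rewrite mxRB mulmxBr.
  have := x1 i0; have := x2 i0.
  have U12 : `|((xa z1).1 - (xa z2).1) i0 0| <= c ^+ k.
    apply: le_trans (normr_entry_le_eucl_norm _ _) _.
    by apply: (UN (xa z1).2) => //; rewrite a12.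
  move: U12.
  have subE (x y : 'cV[R]_n) : (x - y) i0 0 = x i0 0 - y i0 0 by rewrite !mxE.
  rewrite !subE mulrDr mulr1 [c ^+ k * _]mulrC -!mulrA.
  move: (T * c ^+ k) (c ^+ k) ((_ *m _) i0 0) ((_ *m _) i0 0) => t e p1 p2.
  rewrite !ler_norml; lra.
pose h z : 'I_N * {ffun 'I_n -> 'I_L.+1} :=
  (a z, [ffun i => inord `|(z i 0%R %% L.+1)%Z|%N]).
have hinj : {in Z &, injective h}.
  move=> z1 z2 z1Z z2Z [az /ffunP hz]; apply/matrixP => i j; rewrite ord1.
  have := Ha z1 z2 z1Z z2Z az i; have := congr1 val (hz i); rewrite !ffunE /=.
  have modL (x : int) : (`|(x %% L.+1)%Z| < L.+1)%N by lia.
  by rewrite !inordK//; exact: eq_of_modz_close.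
have /card_uniqP : uniq (map h Z) by rewrite map_inj_in_uniq// uniq_expansions.
rewrite size_map => <-; apply: leq_trans (max_card _) _.
by rewrite card_prod card_ffun !card_ord mulnC.
Qed.

End DigitExpansions.

(** * Logarithmic comparison and conclusion *)

(** Applied with [a = ln G_k], [b = ln N], [t = - ln delta] and [s = - ln c]. Replacing [k] by
    [k + 1] in the denominator costs at most [h / (k * s)], because [a <= k * h]. *)
Lemma log_ratio_close {R : realType} (a b t s k h e p : R) :
  0 < k -> 0 < s -> k * s <= t <= (k + 1) * s ->
  0 <= b -> 0 <= h -> 0 <= e -> 0 <= p -> a <= k * h -> a - e <= b <= a + p ->
  `|b / t - a / (k * s)| <= ((p + h + e) / s) / k.
Proof.
move=> k0 s0 /andP[kt tk] b0 h0 e0 p0 ah /andP[ab ba].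
have ks0 : 0 < k * s by rewrite mulr_gt0.
have ks1 : 0 < (k + 1) * s by rewrite mulr_gt0 ?addr_gt0.
have t0 : 0 < t by apply: lt_le_trans kt.
have -> : (p + h + e) / s / k = (p + h + e) / (k * s).
  by field; rewrite !gt_eqF.
rewrite ler_norml; apply/andP; split.
  have bt : b / ((k + 1) * s) <= b / t by rewrite ler_wpM2l// lef_pV2.
  have aks : a / (k * s) <= b / ((k + 1) * s) + (h + e) / (k * s).
    rewrite -lerBlDr -mulrBl ler_pdivrMr// mulrAC ler_pdivlMr//.
    have : (a - e) * (k * s) <= b * (k * s) by rewrite ler_wpM2r// ltW.
    have : a * s <= k * h * s by rewrite ler_wpM2r// ltW.
    have : 0 <= h * s by rewrite mulr_ge0// ltW.
    have : 0 <= e * s by rewrite mulr_ge0// ltW.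
    nra.
  have : 0 <= p / (k * s) by rewrite divr_ge0// ltW.
  by rewrite -[p + h + e]addrA mulrDl; lra.
have bt : b / t <= b / (k * s) by rewrite ler_wpM2l// lef_pV2.
have : b / (k * s) <= (a + p) / (k * s) by rewrite ler_wpM2r// invr_ge0 ltW.
have : 0 <= (h + e) / (k * s) by rewrite divr_ge0 ?addr_ge0// ltW.
rewrite -[p + h + e]addrA !mulrDl; lra.
Qed.

Lemma prodn_shift_le (g : nat -> nat) (b k m : nat) : (forall j, (g j <= b)%N) ->
  (\prod_(0 <= j < k + m) g j <= (\prod_(0 <= j < k) g j) * b ^ m)%N.
Proof.
move=> gb; elim: m => [|m IHm]; first by rewrite addn0 muln1.
by rewrite addnS big_nat_recr//= expnSr mulnA leq_mul.
Qed.

(* Ds j plays the role of D_{j+1}; G_k = prod_{j<k} |Ds j|. *)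
Theorem mainTheorem6 (R : realType) (n : nat) (A : 'M[int]_n)
  (C : set 'cV[int]_n) (D : {fset 'cV[int]_n}) (Ds : nat -> {fset 'cV[int]_n}) :
  \det A != 0 ->
  inv_similarity R A ->
  complete_residue_system A C ->
  (forall d, d \in D -> C d) ->
  (forall j, Ds j != fset0 /\ (Ds j `<=` D)%fset) ->
  let G := fun k : nat => (\prod_(0 <= j < k) #|` Ds j|)%N in
  let F := [set piAD R A d | d in [set d : nat -> 'cV[int]_n | forall j, d j \in Ds j]] in
  let q := fun k : nat =>
    ((ln (G k)%:R : R) / (k%:R * ln (`|(\det A)%:~R| `^ (n%:R)^-1)))%:E in
  lower_box_dim F = limn_einf q /\ upper_box_dim F = limn_esup q.
Proof.
move=> A0 [c [c01 simA]] [_ Cinj] DC DsD G F q.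
have [c0 c1] := andP c01.
have simB (v : 'cV[R]_n) : eucl_norm (invmx (mxR R A) *m v) = c * eucl_norm v.
  by have := simA v 0; rewrite mulmx0 !subr0.
have Dsub j d : d \in Ds j -> d \in D by apply/fsubsetP; case: (DsD j).
(* A sum over the finite set [D] serves as a bound on all digit norms. *)
pose Delta : R := \sum_(d <- enum_fset D) eucl_norm (mxR R d).
have DsDelta j d : d \in enum_fset (Ds j) -> eucl_norm (mxR R d) <= Delta.
  move=> /Dsub dD; rewrite /Delta (big_rem d)//= lerDl sumr_ge0// => e _.
  by rewrite sqrtr_ge0.
have Ds0 j : enum_fset (Ds j) != [::].
  by have [+ _] := DsD j; rewrite -cardfs_eq0 -size_eq0.
have resDs j d1 d2 : d1 \in enum_fset (Ds j) -> d2 \in enum_fset (Ds j) ->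
    (exists w : 'cV[int]_n, d1 - d2 = A *m w) -> d1 = d2.
  by move=> /Dsub/DC C1 /Dsub/DC C2; exact: Cinj.
have upper := @covered_expansions R n A c Delta A0 c01 simB _ DsDelta Ds0.
have lower := @covered_ge R n A c Delta A0 c01 simB _ DsDelta Ds0
  (fun j => fset_uniq (Ds j)) resDs.
set T := Delta / (1 - c) in upper lower.
pose s := - ln c.
have s0 : 0 < s by rewrite oppr_gt0 ln_lt0.
(* For n = 0 the root of the determinant is 1 rather than 1/c, but then every
   Ds j is a singleton and both quotients vanish. *)
have qE k : q k = (ln (G k)%:R / (k%:R * s))%:E.
  have [n0|n0] := posnP n; last first.
    by rewrite /q (ln_root_det A c)// (similarity_det _ _ simB).
  have G1 : G k = 1%N.
    rewrite /G big1// => j _.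
    suff -> : Ds j = [fset 0]%fset by rewrite cardfs1.
    have flat (z : 'cV[int]_n) : z = 0.
      by apply/matrixP => i; move: (leq_ltn_trans (leq0n i) (ltn_ord i)); lia.
    apply/fsetP => z; rewrite inE (flat z) eqxx.
    by have [/fset0Pn[x]] := DsD j; rewrite (flat x).
  by rewrite /q G1 ln1 !mul0r.
have D1 : (0 < #|` D|)%N.
  have [/fset0Pn[x /Dsub xD] _] := DsD 0%N.
  by rewrite cardfs_gt0; apply/fset0Pn; exists x.
have gD j : (#|` Ds j| <= #|` D|)%N by apply: fsubset_leq_card; case: (DsD j).
have Gpos k : (0 < G k)%N.
  by apply: prodn_gt0 => j; rewrite cardfs_gt0; case: (DsD j).
(* With [m] extra levels, the boxes at depth [k + m] have diameter at most [c ^+ k.+1], below every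
   [d] of the [k]-th scale. *)
have [m Mm] : exists m, n%:R * (2 * T) * c ^+ m <= c.
  have /cvgrPdist_le /(_ c c0) [m _ /(_ m (leqnn m))] :
      geometric (n%:R * (2 * T)) c x @[x --> \oo] --> 0.
    by apply: cvg_geometric; rewrite gtr0_norm.
  rewrite /geometric /= sub0r normrN => /(le_trans (ler_norm _)) Mm.
  by exists m.
pose L := Num.bound `|n%:R * (2 * T + 1)|.
have TL : n%:R * (2 * T + 1) <= L%:R.
  exact: le_trans (ler_norm _) (ltW (archi_boundP (normr_ge0 _))).
pose h : R := ln #|` D|%:R.
pose e : R := ln (L.+1 ^ n)%:R.
have h0 : 0 <= h by rewrite /h ln_ge0// ler1n.
have e0 : 0 <= e by rewrite /e ln_ge0// ler1n expn_gt0.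
(* [m%:R * h] pays for the [m] extra levels, the single [h] for the shift of denominator, and [e]
   for the multiplicity [L.+1 ^ n]. *)
have scale k d : (0 < k)%N -> c ^+ k.+1 < d <= c ^+ k ->
    exists2 x, box_ratio F d = x%:E &
      `|x - ln (G k)%:R / (k%:R * s)| <= ((m%:R * h + h + e) / s) / k%:R.
  move=> k0 /andP[cd dc].
  have d0 : 0 < d by apply: lt_trans cd; rewrite exprn_gt0.
  have Fd : covered F d (G (k + m)).
    apply: covered_le (upper (k + m)%N); apply: le_trans (ltW cd).
    by rewrite exprD exprSr mulrA mulrCA ler_pM2l ?exprn_gt0.
  have [N [FN FdN NG]] := cover_num_covered F d _ Fd.
  have GN : (G k <= L.+1 ^ n * N)%N by apply: lower => //; exact: covered_le FdN.
  have N0 : (0 < N)%N by move: (leq_trans (Gpos k) GN); rewrite muln_gt0 => /andP[].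
  exists (ln N%:R / - ln d); first by rewrite /box_ratio FN.
  apply: log_ratio_close => //.
  - by rewrite ltr0n.
  - apply/andP; split.
      by rewrite /s mulrN lerN2 mulr_natl -lnXn// ler_ln ?posrE// exprn_gt0.
    rewrite /s mulrN lerN2 natr1 mulr_natl -lnXn// ler_ln ?posrE ?exprn_gt0//.
    exact: ltW.
  - by rewrite ln_ge0// ler1n.
  - by rewrite mulr_ge0.
  - rewrite /h mulr_natl -lnXn ?ltr0n// ler_ln ?posrE ?exprn_gt0 ?ltr0n//.
    rewrite -natrX ler_nat; have := prodn_shift_le _ _ 0 k gD.
    by rewrite big_nil mul1n.
  - apply/andP; split.
      rewrite lerBlDl -lnM ?posrE ?ltr0n ?expn_gt0// -natrM.
      by rewrite ler_ln ?posrE ?ltr0n ?muln_gt0 ?expn_gt0 ?N0// ler_nat.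
    rewrite /h mulr_natl -lnXn ?ltr0n// -lnM ?posrE ?exprn_gt0 ?ltr0n//.
    rewrite -natrX -natrM ler_ln ?posrE ?ltr0n ?muln_gt0 ?Gpos ?expn_gt0 ?D1//.
    by rewrite ler_nat (leq_trans NG)// prodn_shift_le.
rewrite (funext qE); split.
  exact: limf_einf_geometric c01 scale.
exact: limf_esup_geometric c01 scale.
Qed.
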